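(* Let $D=(E,\mathcal F)$ be a vf-safe delta-matroid, and let $S\subseteq E$. Then there exists $A\subseteq S$, with an ordering $e_1,\ldots,e_k$ of the elements of $A$, such that $$\omega(D^{\ast\times\ast|A})=\max_{B\subseteq S}\omega(D^{\ast\times\ast|B}),$$ and the sequence $$\omega(D),\ \omega(D^{\ast\times\ast|\{e_1\}}),\ \omega(D^{\ast\times\ast|\{e_1,e_2\}}),\ \ldots,\ \omega(D^{\ast\times\ast|A})$$ is non-decreasing.
   Context: A set system is a pair $D=(E,\mathcal F)$ with $E$ a finite set and $\mathcal F\subseteq 2^E$; the members of $\mathcal F$ are the feasible sets. $D$ is proper if $\mathcal F\neq\emptyset$. A delta-matroid is a proper set system such that for all $X,Y\in\mathcal F$ and every $u\in X\triangle Y$ there exists $v\in X\triangle Y$ (possibly $v=u$) with $X\triangle\{u,v\}\in\mathcal F$, where $\triangle$ is symmetric difference. For proper $D$, $r(D_{\max})$ and $r(D_{\min})$ denote the largest and smallest cardinality of a feasible set, and the width is $\omega(D)=r(D_{\max})-r(D_{\min})$. Twist: for $A\subseteq E$, $D^{\ast|A}=(E,\{F\triangle A\mid F\in\mathcal F\})$. Loop complementation: for $e\in E$, $D^{\times|e}=(E,\mathcal F')$ with $\mathcal F'=\mathcal F\,\triangle\,\{F\cup\{e\}\mid F\in\mathcal F,\ e\notin F\}$. Loop complementations on distinct elements commute, and for $A\subseteq E$, $D^{\times|A}$ is obtained by applying loop complementation to every element of $A$. These operations preserve properness. Words are read left to right: $D^{\ast\times\ast|A}=((D^{\ast|A})^{\times|A})^{\ast|A}$.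 A delta-matroid $D$ is vf-safe if every set system obtained from $D$ by an arbitrary finite sequence of twists and loop complementations (on elements or subsets of $E$) is again a delta-matroid. *)

(* Defs.v *)
From mathcomp Require Import all_boot.
Set Implicit Arguments.
Unset Strict Implicit.
Unset Printing Implicit Defensive.

Definition symdiff (T : finType) (A B : {set T}) : {set T} :=
  (A :\: B) :|: (B :\: A).

Lemma in_symdiff (T : finType) (A B : {set T}) (x : T) :
  (x \in symdiff A B) = (x \in A) (+) (x \in B).
Proof. by rewrite !inE; case: (x \in A); case: (x \in B). Qed.

(* The ground set is the whole finite type E, so a set system on E is just
   its collection of feasible sets. *)
Notation set_system E := {set {set E}}.

Definition proper_system (E : finType) (D : set_system E) : Prop := D != set0.

Definition delta_matroid (E : finType) (D : set_system E) : Prop :=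
  proper_system D /\
  forall X Y : {set E}, X \in D -> Y \in D ->
  forall u : E, u \in symdiff X Y ->
  exists2 v : E, v \in symdiff X Y & symdiff X [set u; v] \in D.

Definition rmax (E : finType) (D : set_system E) : nat := \max_(F in D) #|F|.

(* The neutral value #|E| bounds every #|F|, so for proper D this is the
   smallest cardinality of a feasible set. *)
Definition rmin (E : finType) (D : set_system E) : nat :=
  \big[minn/#|E|]_(F in D) #|F|.

Lemma rmin_le (E : finType) (D : set_system E) (F : {set E}) :
  F \in D -> rmin D <= #|F|.
Proof.
rewrite /rmin => FD; have := mem_index_enum F.
elim: (index_enum _) => //= G s IHs; rewrite inE big_cons.
case/predU1P=> [<-|/IHs leF]; first by rewrite FD geq_minl.
by case: ifP => // _; apply: leq_trans (geq_minr _ _) leF.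
Qed.

Lemma rmin_attained (E : finType) (D : set_system E) :
  proper_system D -> exists2 F, F \in D & #|F| = rmin D.
Proof.
case/set0Pn=> F0 F0D.
pose F := [arg min_(F < F0 in D) #|F|].
have [FD minF] : F \in D /\ forall G, G \in D -> #|F| <= #|G|.
  by rewrite /F; case: arg_minnP => // G GD minG; split.
exists F => //; apply/eqP; rewrite eqn_leq rmin_le // andbT.
rewrite /rmin; elim/big_ind: _ => [|m n|G /minF //]; first exact: max_card.
by rewrite leq_min => -> ->.
Qed.

Definition width (E : finType) (D : set_system E) : nat := rmax D - rmin D.

Definition twist (E : finType) (A : {set E}) (D : set_system E) :
  set_system E := [set symdiff F A | F in D].

Definition loopc1 (E : finType) (e : E) (D : set_system E) : set_system E :=
  symdiff D [set e |: F | F in D & e \notin F].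

(* By perm_loopc1 below, the order in which the elements of A are taken does
   not matter. *)
Definition loopc (E : finType) (A : {set E}) (D : set_system E) :
  set_system E := foldr (@loopc1 E) D (enum A).

Lemma in_loopc1 (E : finType) (e : E) (D : set_system E) (X : {set E}) :
  (X \in loopc1 e D) = (X \in D) (+) ((e \in X) && (X :\ e \in D)).
Proof.
rewrite in_symdiff; congr (_ (+) _).
apply/imsetP/andP=> [[F]|[eX XD]].
  by rewrite inE => /andP[FD eF] ->; rewrite setU11 setU1K.
by exists (X :\ e); rewrite ?inE ?XD ?eqxx //= setD1K.
Qed.

Lemma loopc1C (E : finType) (e f : E) (D : set_system E) :
  loopc1 e (loopc1 f D) = loopc1 f (loopc1 e D).
Proof.
have [->//|ef] := eqVneq e f.
apply/setP=> X; rewrite !in_loopc1 !in_setD1 ef (eq_sym f) ef /=.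
have -> : X :\ f :\ e = X :\ e :\ f by rewrite !setDDl setUC.
by case: (e \in X); case: (f \in X); rewrite ?andbF ?addbF //= addbACA.
Qed.

Lemma perm_loopc1 (E : finType) (s t : seq E) (D : set_system E) :
  perm_eq s t -> foldr (@loopc1 E) D s = foldr (@loopc1 E) D t.
Proof.
move: s t; apply: catCA_perm_subst => s1 s2 s3.
have loopc1_foldr e t D' : loopc1 e (foldr (@loopc1 E) D' t) =
    foldr (@loopc1 E) (loopc1 e D') t.
  by elim: t => //= f t <-; rewrite loopc1C.
rewrite !foldr_cat; elim: s1 (foldr _ _ s3) => //= e s1 IHs D'.
by rewrite IHs -!loopc1_foldr.
Qed.

(* D^{* x * | A}, read left to right *)
Definition tlt (E : finType) (A : {set E}) (D : set_system E) :
  set_system E := twist A (loopc A (twist A D)).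

Inductive tl_reachable (E : finType) (D : set_system E) :
  set_system E -> Prop :=
| tl_refl : tl_reachable D D
| tl_twist (A : {set E}) (D' : set_system E) :
    tl_reachable D D' -> tl_reachable D (twist A D')
| tl_loopc (A : {set E}) (D' : set_system E) :
    tl_reachable D D' -> tl_reachable D (loopc A D').

Definition vf_safe (E : finType) (D : set_system E) : Prop :=
  forall D' : set_system E, tl_reachable D D' -> delta_matroid D'.

(* Main.v *)
(** A set belongs to [D^{*x*|e}] iff an odd number of [X], [X U e] (for [e] not
    in [X]) is feasible, so the operation preserves [rmax] and only [rmin]
    matters.  If [e] lies in a minimum-size feasible set, applying the operation
    to [e] lowers [rmin], and the new minimum-size sets are old ones with [e]
    removed; hence greedily processing such [e] in [S] never meets an element
    twice and stops at a system [D'] whose minimum-size sets all avoid [S].  In a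
    delta-matroid every feasible set [G] contains a minimum-size one, so
    [|G - S| >= rmin D'].  Further operations on elements of [S] only produce
    feasible sets that agree outside [S] with feasible sets of [D'], so they
    cannot go below [rmin D']. *)
Require Import Defs.
From mathcomp Require Import all_boot.
Set Implicit Arguments.
Unset Strict Implicit.
Unset Printing Implicit Defensive.

Section Width.

Variable E : finType.
Implicit Types (D : set_system E) (A B S F G X : {set E}) (e : E) (s : seq E).

Lemma symdiffK A : involutive (fun X => symdiff X A).
Proof. by move=> X; apply/setP=> x; rewrite !in_symdiff addbK. Qed.

Lemma in_twist A D X : (X \in twist A D) = (symdiff X A \in D).
Proof.
apply/imsetP/idP=> [[F FD ->]|XD]; first by rewrite symdiffK.
by exists (symdiff X A); rewrite ?symdiffK.
Qed.

Lemma twistK A : involutive (@twist E A).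
Proof. by move=> D; apply/setP=> X; rewrite !in_twist symdiffK. Qed.

(* D^{* x * | e} *)
Definition tlt1 e D : set_system E :=
  [set X | (X \in D) (+) ((e \notin X) && (e |: X \in D))].

Lemma in_tlt1 e D X :
  (X \in tlt1 e D) = (X \in D) (+) ((e \notin X) && (e |: X \in D)).
Proof. by rewrite inE. Qed.

Lemma tlt1K e : involutive (tlt1 e).
Proof.
move=> D; apply/setP=> X; rewrite !in_tlt1 setU11 /= addbF.
by case: (e \in X); rewrite /= ?addbF // addbK.
Qed.

(** Twisting by a set containing [e] flips membership of [e], so removing [e] from the twisted set
    amounts to adding it to [X]. *)
Lemma twist_loopc1 e A D :
  e \in A -> twist A (loopc1 e D) = tlt1 e (twist A D).
Proof.
move=> eA; apply/setP=> X.
rewrite in_twist in_loopc1 in_tlt1 !in_twist in_symdiff eA addbT.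
case: (boolP (e \in X)) => //= eX; congr (_ (+) (_ \in D)).
apply/setP=> x; rewrite in_setD1 !in_symdiff in_setU1.
by case: eqVneq => //= ->; rewrite eA.
Qed.

(** The outer twist is pushed through the loop complementations one at a time, until it meets and
    cancels the inner twist. *)
Lemma tlt_foldl s D :
  uniq s -> tlt [set x in s] D = foldl (fun D' e => tlt1 e D') D s.
Proof.
move=> Us; set A := [set x in s].
have -> : tlt A D = twist A (foldr (@loopc1 E) (twist A D) (rev s)).
  congr twist; apply: perm_loopc1; rewrite uniq_perm ?enum_uniq ?rev_uniq //.
  by move=> x; rewrite mem_enum mem_rev inE.
rewrite -[s in RHS]revK foldl_rev.
have: {subset rev s <= A} by move=> x; rewrite mem_rev inE.
elim: (rev s) => [|e t IHt] sA /=; first exact: twistK.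
rewrite twist_loopc1 ?sA ?mem_head // IHt // => x xt.
by apply: sA; rewrite inE xt orbT.
Qed.

(** This allows a comparison of [tlt B D] with the greedy result: undo the greedy steps, then
    process [B]. *)
Lemma foldl_tlt1K s D :
  foldl (fun D' e => tlt1 e D') (foldl (fun D' e => tlt1 e D') D s) (rev s) = D.
Proof. by elim/last_ind: s => //= s e IHs; rewrite rev_rcons foldl_rcons /= tlt1K. Qed.

Lemma tlt1_feasible e D X :
  X \in tlt1 e D -> exists2 Y, Y \in D & X \subset Y /\ Y \subset e |: X.
Proof.
rewrite in_tlt1; case: (boolP (X \in D)) => [XD _|_ /= /andP[_ eXD]].
  by exists X; rewrite ?subsetU1.
by exists (e |: X); rewrite ?subsetU1.
Qed.

Lemma foldl_tlt1_feasible S s D X :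
    {subset s <= S} -> X \in foldl (fun D' e => tlt1 e D') D s ->
  exists2 Y, Y \in D & Y :\: S \subset X.
Proof.
elim/last_ind: s X => [|s e IHs] X sS /=.
  by exists X; rewrite ?subsetDl.
rewrite foldl_rcons => /tlt1_feasible[Y Ys [_ YX]].
have [|Z ZD ZY] := IHs Y _ Ys.
  by move=> x xs; apply: sS; rewrite mem_rcons inE xs orbT.
exists Z => //; apply/subsetP=> x xZS; have /setDP[_ xS] := xZS.
have := subsetP YX x (subsetP ZY x xZS).
by case/setU1P=> // xe; case/negP: xS; apply: sS; rewrite xe mem_rcons mem_head.
Qed.

(** Every new feasible set lies inside an old one, which gives one inequality; the involution gives
    the other. *)
Lemma rmax_tlt1 e D : rmax (tlt1 e D) = rmax D.
Proof.
have le_rmax D' : rmax (tlt1 e D') <= rmax D'.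
  apply/bigmax_leqP=> X /tlt1_feasible[Y YD [XY _]].
  exact: leq_trans (subset_leq_card XY) (leq_bigmax_cond _ YD).
by apply/eqP; rewrite eqn_leq le_rmax -{1}(tlt1K e D) le_rmax.
Qed.

Lemma rmax_tlt A D : rmax (tlt A D) = rmax D.
Proof.
have -> : A = [set x in enum A] by apply/setP=> x; rewrite inE mem_enum.
rewrite tlt_foldl ?enum_uniq //.
by elim: (enum A) D => //= e s IHs D; rewrite IHs rmax_tlt1.
Qed.

Definition minfeas D : set_system E := [set F in D | #|F| == rmin D].

(** Take a minimum-size [F] with [#|F :\: G|] least. If some [u] of [F] were outside [G], exchange
    would replace [u] by some [v] in [G], giving a minimum-size set closer to [G]. *)
Lemma minfeas_sub D G :
  delta_matroid D -> G \in D -> exists2 F, F \in minfeas D & F \subset G.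
Proof.
case=> Dproper exch GD.
have [F0 F0D F0min] := rmin_attained Dproper.
have F0m : F0 \in minfeas D by rewrite inE F0D F0min eqxx.
case: (arg_minnP (fun F => #|F :\: G|) F0m) => F /= Fm minF.
exists F => //; apply/subsetP=> u uF; apply: contraT => uG.
have /setIdP[FD /eqP Fmin] := Fm.
have [|v vFG F'D] := exch F G FD GD u; first by rewrite in_symdiff uF (negPf uG).
set F' := symdiff F [set u; v] in F'D.
have inF' x : (x \in F') = (x \in F) (+) ((x == u) || (x == v)).
  by rewrite in_symdiff in_set2.
(* If v were in F as well, F' would be smaller than the minimum. *)
have vF : v \notin F.
  apply/negP=> vF; have: F' \proper F; last first.
    by move/proper_card; rewrite Fmin ltnNge rmin_le.
  apply/properP; split; last by exists u; rewrite ?inF' ?uF ?eqxx.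
  apply/subsetP=> x; rewrite inF'; case: (boolP (x \in F)) => //= xF.
  by case/orP=> /eqP xE; rewrite xE ?uF ?vF in xF.
have vG : v \in G by move: vFG; rewrite in_symdiff (negPf vF).
have F'E : F' = v |: F :\ u.
  apply/setP=> x; rewrite inF' !inE.
  have [->|_] := eqVneq x u; last first.
    by have [->|_] := eqVneq x v; rewrite ?(negPf vF) ?addbF.
  by rewrite uF orbF; case: eqVneq => // uv; rewrite -uv uF in vF.
have F'm : F' \in minfeas D.
  rewrite inE F'D F'E cardsU1 !inE (negPf vF) andbF /=.
  by rewrite -Fmin (cardsD1 u F) uF.
have /minF := F'm; rewrite leqNgt => /negP[]; apply: proper_card.
apply/properP; split; last first.
  exists u; first by rewrite inE uF uG.
  by rewrite F'E !inE uG eqxx orbF; apply: contraNneq uG => ->.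
apply/subsetP=> x; rewrite F'E !inE => /andP[xG].
by case/orP=> [/eqP xv|/andP[_ ->]]; [rewrite xv vG in xG | rewrite xG].
Qed.

(** By minimality [F :\ e] is not in [D], so it becomes feasible. A new minimum-size [X] is too
    small to be in [D], so it arises from [e |: X] in [D], whose size is at most, hence equal to,
    [rmin D]. *)
Lemma minfeas_tlt1 e D :
    e \in cover (minfeas D) ->
  width D <= width (tlt1 e D) /\
  cover (minfeas (tlt1 e D)) \subset cover (minfeas D) :\ e.
Proof.
case/bigcupP=> F /setIdP[FD /eqP Fmin] eF.
have rlt : rmin (tlt1 e D) < rmin D.
  have FeD : F :\ e \notin D.
    by apply/negP=> /rmin_le; rewrite -Fmin (cardsD1 e F) eF ltnn.
  rewrite -Fmin (cardsD1 e F) eF ltnS rmin_le // in_tlt1 (negPf FeD).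
  by rewrite !inE eqxx setD1K.
split; first by rewrite /width rmax_tlt1 leq_sub2l // ltnW.
apply/bigcupsP=> X /setIdP[+ /eqP Xmin]; rewrite in_tlt1.
have XD : X \notin D.
  by apply/negP=> /rmin_le; rewrite leqNgt Xmin rlt.
rewrite (negPf XD) /= => /andP[eX eXD].
have eXm : e |: X \in minfeas D.
  by rewrite inE eXD eqn_leq rmin_le // cardsU1 eX Xmin rlt.
rewrite subsetD1 eX andbT (subset_trans (subsetU1 e X)) //.
exact: (bigcup_sup (e |: X)).
Qed.

Lemma greedy_sequence S D :
  exists s, [/\ uniq s, {subset s <= S :&: cover (minfeas D)},
    [disjoint cover (minfeas (foldl (fun D' e => tlt1 e D') D s)) & S] &
    sorted leq (width D :: mkseq (fun i =>
      width (foldl (fun D' e => tlt1 e D') D (take i.+1 s))) (size s))].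
Proof.
(* Processing [e] removes it from the cover and adds nothing, so this cardinality strictly drops and
   [e] cannot recur. *)
have [n] := ubnP #|S :&: cover (minfeas D)|.
elim: n D => // n IHn D leDn.
have [C0|[e eC]] := set_0Vmem (S :&: cover (minfeas D)).
  by exists [::]; split=> //=; rewrite -setI_eq0 setIC C0.
have [eS em] := setIP eC.
have [le_width sub] := minfeas_tlt1 em.
have subI : S :&: cover (minfeas (tlt1 e D)) \subset
    (S :&: cover (minfeas D)) :\ e by rewrite setDE -setIA setIS // -setDE.
have [|s [Us sC dis srt]] := IHn (tlt1 e D).
  rewrite (cardsD1 e) eC ltnS in leDn.
  exact: leq_ltn_trans (subset_leq_card subI) leDn.
exists (e :: s); split=> //.
- by rewrite /= Us andbT; apply/negP=> /sC/(subsetP subI); rewrite !inE eqxx.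
- move=> x /predU1P[->//|/sC/(subsetP subI)].
  by rewrite in_setD1 => /andP[].
(* The prefix of length one gives [tlt1 e D]; the longer prefixes are those of [s], with indices
   shifted by one. *)
rewrite /mkseq /= take0 /= le_width /= -[1]addn0 iotaDl -map_comp.
exact: srt.
Qed.

Lemma rmin_foldl_tlt1 S s D :
    delta_matroid D -> [disjoint cover (minfeas D) & S] -> {subset s <= S} ->
    proper_system (foldl (fun D' e => tlt1 e D') D s) ->
  rmin D <= rmin (foldl (fun D' e => tlt1 e D') D s).
Proof.
move=> dD dis sS /rmin_attained[X XD <-].
have [Y YD YX] := foldl_tlt1_feasible sS XD.
have [F Fm FY] := minfeas_sub dD YD.
have /setIdP[_ /eqP <-] := Fm.
(* [F] avoids [S], so it lies in [Y :\: S] and hence in [X]. *)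
apply/subset_leq_card/(subset_trans _ YX); rewrite subsetD FY /=.
by apply: disjointWl dis; exact: (bigcup_sup F).
Qed.

Lemma tlt_delta_matroid A D : vf_safe D -> delta_matroid (tlt A D).
Proof. by apply; apply/tl_twist/tl_loopc/tl_twist/tl_refl. Qed.

End Width.

Theorem theorem4p11 (E : finType) (D : set_system E) (S : {set E})
    (hD : delta_matroid D) (hvf : vf_safe D) :
  exists (A : {set E}) (s : seq E),
    [/\ A \subset S,
        uniq s /\ s =i A,
        width (tlt A D) = \max_(B : {set E} | B \subset S) width (tlt B D)
      & sorted leq (width D ::
          mkseq (fun i => width (tlt [set x in take i.+1 s] D)) (size s))].
Proof.
have [s [Us sC dis srt]] := greedy_sequence S D.
have sS : {subset s <= S} by move=> x /sC/setIP[].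
have AS : [set x in s] \subset S by apply/subsetP=> x; rewrite inE => /sS.
exists [set x in s], s; split=> //.
- by split=> // x; rewrite inE.
- apply/eqP; rewrite eqn_leq; apply/andP; split.
    exact: (leq_bigmax_cond (F := fun B => width (tlt B D)) _ AS).
  (* Since [rmax] never changes, the largest width means the smallest [rmin]. *)
  apply/bigmax_leqP=> B BS; rewrite /width !rmax_tlt leq_sub2l //.
  have dA := tlt_delta_matroid [set x in s] hvf.
  have [] := tlt_delta_matroid B hvf.
  have -> : tlt B D =
      foldl (fun D' e => tlt1 e D') (tlt [set x in s] D) (rev s ++ enum B).
    rewrite foldl_cat tlt_foldl // foldl_tlt1K -tlt_foldl ?enum_uniq //.
    by congr (tlt _ D); apply/setP=> x; rewrite inE mem_enum.
  rewrite -tlt_foldl // in dis.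
  move=> Bproper _; apply: rmin_foldl_tlt1 dA dis _ Bproper => x.
  by rewrite mem_cat mem_rev mem_enum => /orP[/sS|/(subsetP BS)].
rewrite (@eq_mkseq _ _ (fun i =>
  width (foldl (fun D' e => tlt1 e D') D (take i.+1 s)))) // => i.
by rewrite tlt_foldl // take_uniq.
Qed.
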